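(* Let $n\in\mathbb N$. The matricially normed space $\widehat M_n$ is $\odot_n$-free with a one-point set as its base.
   Context: All linear spaces are complex. $M_n$ is the linear space of $n\times n$ complex matrices, $\|\cdot\|_o$ the operator norm on it. For a linear space $E$, $M_n(E)$ is the space of $n\times n$ matrices with entries in $E$ (identified with $M_n\otimes E$); $u\oplus w$ denotes the block-diagonal matrix with blocks $u,w$. The closed unit ball of a normed space $X$ is $B_X$. A matrix-norm on $E$ is a sequence of norms $\|\cdot\|_n$ on $M_n(E)$, $n\in\mathbb N$, such that (Axiom 1) $\|u\oplus 0\|_{n+m}=\|u\|_n$ for $u\in M_n(E)$ and $0\in M_m(E)$; (Axiom 2) $\|Su\|_n\le\|S\|_o\|u\|_n$ and $\|uS\|_n\le\|u\|_n\|S\|_o$ for $u\in M_n(E)$, $S\in M_n$. A matricially normed space is a linear space with a matrix-norm. For a linear operator $\varphi:E\to F$, its $m$-th amplification is $\varphi_m:M_m(E)\to M_m(F)$, $(x_{ij})\mapsto(\varphi(x_{ij}))$. Between matricially normed spaces, $\varphi$ is completely contractive if every $\varphi_m$ is contractive. $\mathbf{MN_1}$ is the category of matricially normed spaces and completely contractive operators. The space $\widehat M_n$: for a linear space $E$ and $v=(x_{ij})\in M_n(E)$ let $\varphi^v:M_n\to E$, $(\lambda_{ij})\mapsto\sum_{i,j}\lambda_{ji}x_{ij}$. $\widehat M_n$ is $M_n$ with the matrix-norm given on $u\in M_m(M_n)$ by $\|u\|_m:=\sup\|(\varphi^v)_m(u)\|_m$, the supremum taken over all pairs $(E,v)$ with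 $E$ a matricially normed space and $v\in B_{M_n(E)}$. The functor $\odot_n:\mathbf{MN_1}\to\mathbf{Set}$ takes $E$ to the set $B_{M_n(E)}$ and a completely contractive operator $\varphi:E\to F$ to the restriction of $\varphi_n$ to a map $B_{M_n(E)}\to B_{M_n(F)}$. A matricially normed space $P$ is $\odot_n$-free with base the set $M$ if for every matricially normed space $E$ there is a bijection, natural in $E$, from the set of maps $M\to\odot_n(E)$ onto the set of completely contractive operators $P\to E$. *)

(* Defs.v *)
From HB Require Import structures.
From mathcomp Require Import all_boot all_order all_algebra.
From mathcomp Require Import boolp classical_sets reals complex.
From mathcomp Require Import ring.
Set Implicit Arguments.
Unset Strict Implicit.
Unset Printing Implicit Defensive.
Import Order.TTheory GRing.Theory Num.Theory.
Import Normc.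
Local Open Scope classical_set_scope.
Local Open Scope ring_scope.

Section OperatorNorm.
Variable R : realType.
Local Notation C := R[i].

Definition l2norm (n : nat) (x : 'cV[C]_n) : R :=
  Num.sqrt (\sum_i normc (x i 0) ^+ 2).

Definition opnorm (n : nat) (S : 'M[C]_n) : R :=
  sup [set l2norm (S *m x) | x in [set x : 'cV[C]_n | l2norm x <= 1]].

Lemma normc_ge0 (z : C) : 0 <= normc z.
Proof. by case: z => a b; exact: sqrtr_ge0. Qed.

Lemma normcD (z w : C) : normc (z + w) <= normc z + normc w.
Proof. exact: (@le_normcD R). Qed.

Lemma normc_sum (I : Type) (r : seq I) (F : I -> C) :
  normc (\sum_(i <- r) F i) <= \sum_(i <- r) normc (F i).
Proof.
elim: r => [|i r IH]; first by rewrite !big_nil normc0.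
by rewrite !big_cons (le_trans (normcD _ _)) // lerD2l.
Qed.

Lemma l2sum_ge0 n (x : 'cV[C]_n) : 0 <= \sum_i normc (x i 0) ^+ 2.
Proof. by apply: sumr_ge0 => i _; exact: sqr_ge0. Qed.

Lemma l2norm_ge0 n (x : 'cV[C]_n) : 0 <= l2norm x.
Proof. exact: sqrtr_ge0. Qed.

Lemma l2norm_sqr n (x : 'cV[C]_n) : l2norm x ^+ 2 = \sum_i normc (x i 0) ^+ 2.
Proof. by rewrite sqr_sqrtr // l2sum_ge0. Qed.

Lemma l2norm0 n : l2norm (0 : 'cV[C]_n) = 0.
Proof.
rewrite /l2norm big1 ?sqrtr0 // => i _.
by rewrite mxE normc0 expr0n.
Qed.

Lemma l2normZ n (a : C) (x : 'cV[C]_n) : l2norm (a *: x) = normc a * l2norm x.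
Proof.
rewrite /l2norm.
under eq_bigr do rewrite mxE normcM exprMn.
by rewrite -mulr_sumr sqrtrM ?sqr_ge0 // sqrtr_sqr ger0_norm ?normc_ge0.
Qed.

Lemma l2norm_entry n (x : 'cV[C]_n) i : normc (x i 0) <= l2norm x.
Proof.
rewrite -(ler_pXn2r (ltn0Sn 1)) ?nnegrE ?normc_ge0 ?l2norm_ge0 //.
rewrite l2norm_sqr (bigD1 i) //= lerDl.
by apply: sumr_ge0 => j _; exact: sqr_ge0.
Qed.

Lemma l2norm_le_l1 n (x : 'cV[C]_n) : l2norm x <= \sum_i normc (x i 0).
Proof.
have s0 (r : seq 'I_n) : 0 <= \sum_(i <- r) normc (x i 0).
  by apply: sumr_ge0 => i _; exact: normc_ge0.
rewrite -(ler_pXn2r (ltn0Sn 1)) ?nnegrE ?l2norm_ge0 // l2norm_sqr.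
elim: (index_enum _) => [|i r IH]; first by rewrite !big_nil expr0n.
rewrite !big_cons sqrrD -addrA lerD2l (le_trans IH) // lerDr.
by rewrite mulrn_wge0 // mulr_ge0 ?normc_ge0.
Qed.

Lemma l2norm_eq0 n (x : 'cV[C]_n) : l2norm x = 0 -> x = 0.
Proof.
move=> x0; apply/matrixP => i j; rewrite (ord1 j) mxE; apply: eq0_normc.
by apply/le_anti; rewrite normc_ge0 andbT -x0 l2norm_entry.
Qed.

Lemma cauchy_schwarz_sum n (a b : 'I_n -> R) :
  (\sum_i a i * b i) ^+ 2 <= (\sum_i a i ^+ 2) * (\sum_i b i ^+ 2).
Proof.
rewrite -subr_ge0 -(pmulrn_lge0 _ (ltn0Sn 1)).
suff -> : ((\sum_i a i ^+ 2) * (\sum_i b i ^+ 2) - (\sum_i a i * b i) ^+ 2) *+ 2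
  = \sum_i \sum_j (a i * b j - a j * b i) ^+ 2.
  by apply: sumr_ge0 => i _; apply: sumr_ge0 => j _; exact: sqr_ge0.
have E1 : (\sum_i a i ^+ 2) * (\sum_i b i ^+ 2)
          = \sum_i \sum_j (a i ^+ 2 * b j ^+ 2).
  by rewrite mulr_suml; apply: eq_bigr => i _; rewrite mulr_sumr.
have E2 : (\sum_i a i ^+ 2) * (\sum_i b i ^+ 2)
          = \sum_i \sum_j (a j ^+ 2 * b i ^+ 2).
  by rewrite E1 exchange_big.
have E3 : (\sum_i a i * b i) ^+ 2 = \sum_i \sum_j (a i * b j * (a j * b i)).
  rewrite expr2 mulr_suml; apply: eq_bigr => i _; rewrite mulr_sumr.
  by apply: eq_bigr => j _; ring.
rewrite mulrnBl mulr2n {1}E1 E2 E3 -big_split /= .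
rewrite -sumrMnl -sumrB; apply: eq_bigr => i _.
rewrite -big_split /= -sumrMnl -sumrB; apply: eq_bigr => j _.
by rewrite sqrrB !exprMn addrAC.
Qed.

Lemma l2normD n (x y : 'cV[C]_n) : l2norm (x + y) <= l2norm x + l2norm y.
Proof.
rewrite -(ler_pXn2r (ltn0Sn 1)) ?nnegrE ?addr_ge0 ?l2norm_ge0 //.
rewrite sqrrD !l2norm_sqr.
apply: (@le_trans _ _ (\sum_i (normc (x i 0) + normc (y i 0)) ^+ 2)).
  apply: ler_sum => i _; rewrite mxE.
  by rewrite ler_pXn2r ?nnegrE ?addr_ge0 ?normc_ge0 // normcD.
under eq_bigr do rewrite sqrrD.
rewrite !big_split /= lerD2r lerD2l.
rewrite -mulr2n lerMn2r /=.
rewrite -(ler_pXn2r (ltn0Sn 1)) ?nnegrE ?mulr_ge0 ?l2norm_ge0 //; last first.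
  by apply: sumr_ge0 => i _; rewrite mulr_ge0 ?normc_ge0.
by rewrite exprMn !l2norm_sqr cauchy_schwarz_sum.
Qed.

Let ball_img n (S : 'M[C]_n) :=
  [set l2norm (S *m x) | x in [set x : 'cV[C]_n | l2norm x <= 1]].

Lemma opnorm_has_sup n (S : 'M[C]_n) : has_sup (ball_img S).
Proof.
split; first by exists (l2norm (S *m 0)), 0 => //=; rewrite l2norm0 ler01.
exists (\sum_i \sum_j normc (S i j)) => _ [x /= x1 <-].
apply: (le_trans (l2norm_le_l1 _)); apply: ler_sum => i _; rewrite mxE.
apply: (le_trans (normc_sum _ _)); apply: ler_sum => j _.
by rewrite normcM ler_piMr ?normc_ge0 // (le_trans (l2norm_entry _ _)).
Qed.

Lemma opnorm_ge0 n (S : 'M[C]_n) : 0 <= opnorm S.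
Proof.
apply: (ub_le_sup (proj2 (opnorm_has_sup S))).
by exists 0 => /=; rewrite ?mulmx0 l2norm0 ?ler01.
Qed.

Lemma opnorm_bound n (S : 'M[C]_n) x : l2norm (S *m x) <= opnorm S * l2norm x.
Proof.
have [x0|x0] := eqVneq (l2norm x) 0.
  by rewrite (l2norm_eq0 x0) mulmx0 l2norm0 mulr0.
have xp : 0 < l2norm x by rewrite lt_neqAle eq_sym x0 l2norm_ge0.
pose a : C := ((l2norm x)^-1)%:C%C.
have na : normc a = (l2norm x)^-1.
  by rewrite /a /= expr0n addr0 sqrtr_sqr ger0_norm // invr_ge0 ltW.
rewrite -ler_pdivrMr // mulrC -na -l2normZ scalemxAr.
apply: (ub_le_sup (proj2 (opnorm_has_sup S))).
by exists (a *: x) => //=; rewrite l2normZ na mulVf.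
Qed.

Lemma opnorm_le n (S : 'M[C]_n) (c : R) : 0 <= c ->
  (forall x, l2norm (S *m x) <= c * l2norm x) -> opnorm S <= c.
Proof.
move=> c0 Sc; apply: ge_sup; first exact: (proj1 (opnorm_has_sup S)).
by move=> _ [x /= x1 <-]; rewrite (le_trans (Sc x)) // ler_piMr.
Qed.

Lemma opnormD n (S T : 'M[C]_n) : opnorm (S + T) <= opnorm S + opnorm T.
Proof.
apply: opnorm_le => [|x]; first by rewrite addr_ge0 ?opnorm_ge0.
by rewrite mulmxDl mulrDl (le_trans (l2normD _ _)) // lerD ?opnorm_bound.
Qed.

Lemma opnormM n (S T : 'M[C]_n) : opnorm (S *m T) <= opnorm S * opnorm T.
Proof.
apply: opnorm_le => [|x]; first by rewrite mulr_ge0 ?opnorm_ge0.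
rewrite -mulmxA -mulrA (le_trans (opnorm_bound _ _)) //.
by rewrite ler_wpM2l ?opnorm_ge0 ?opnorm_bound.
Qed.

Lemma opnorm_eq0 n (S : 'M[C]_n) : opnorm S = 0 -> S = 0.
Proof.
move=> S0; apply/matrixP => i j; rewrite mxE.
have /l2norm_eq0/matrixP/(_ i 0) : l2norm (S *m delta_mx j (0 : 'I_1)) = 0.
  by apply/le_anti; rewrite l2norm_ge0 andbT (le_trans (opnorm_bound _ _)) ?S0 ?mul0r.
rewrite !mxE (bigD1 j) //= big1 => [|k kj]; rewrite mxE ?(negPf kj) ?mulr0 //.
by rewrite !eqxx mulr1 addr0.
Qed.

Lemma homogeneousW (T : Type) (N : T -> R) (act : C -> T -> T) :
  (forall a b u, act a (act b u) = act (a * b) u) -> (forall u, act 1 u = u) ->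
  (forall u, N (act 0 u) = 0) ->
  (forall a u, N (act a u) <= normc a * N u) ->
  forall a u, N (act a u) = normc a * N u.
Proof.
move=> actA act1 act0 Nle a u; have [->|a0] := eqVneq a 0.
  by rewrite normc0 mul0r act0.
apply/le_anti; rewrite Nle /=.
have ap : 0 < normc a.
  by rewrite lt_neqAle normc_ge0 andbT eq_sym; apply: contraNneq a0 => /eq0_normc ->.
rewrite -ler_pdivlMl // -normcV.
by have := Nle a^-1 (act a u); rewrite actA mulVf // act1.
Qed.

Lemma opnormZ n (a : C) (S : 'M[C]_n) : opnorm (a *: S) = normc a * opnorm S.
Proof.
apply: (@homogeneousW _ (@opnorm n) (fun a S => a *: S)) => {a S}.
- by move=> a b u; rewrite scalerA.
- by move=> u; rewrite scale1r.
- move=> u; apply/le_anti; rewrite opnorm_ge0 andbT.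
  by apply: opnorm_le => // x; rewrite scale0r mul0mx l2norm0 mul0r.
- move=> a S; apply: opnorm_le => [|x]; first by rewrite mulr_ge0 ?normc_ge0 ?opnorm_ge0.
  by rewrite -scalemxAl l2normZ -mulrA ler_wpM2l ?normc_ge0 ?opnorm_bound.
Qed.

Lemma opnorm_delta n (i j : 'I_n) : opnorm (delta_mx i j : 'M[C]_n) <= 1.
Proof.
apply: opnorm_le => // x; rewrite mul1r; apply: (le_trans _ (l2norm_entry x j)).
rewrite /l2norm (bigD1 i) //= big1 => [|k ki].
  rewrite addr0 sqrtr_sqr ger0_norm ?normc_ge0 // mxE (bigD1 j) //= big1.
    by rewrite !mxE !eqxx mul1r addr0.
  by move=> k kj; rewrite mxE (negPf kj) andbF mul0r.
rewrite mxE big1 ?normc0 ?expr0n // => l _.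
by rewrite mxE (negPf ki) mul0r.
Qed.

Lemma l2norm_col n m (x : 'cV[C]_n) (y : 'cV[C]_m) :
  l2norm (col_mx x y) ^+ 2 = l2norm x ^+ 2 + l2norm y ^+ 2.
Proof.
rewrite !l2norm_sqr big_split_ord /=; congr (_ + _); apply: eq_bigr => i _.
  by rewrite col_mxEu.
by rewrite col_mxEd.
Qed.

Lemma l2norm_col0 n m (x : 'cV[C]_n) : l2norm (col_mx x (0 : 'cV[C]_m)) = l2norm x.
Proof.
apply/eqP; rewrite -(@eqrXn2 _ 2) ?l2norm_ge0 //.
by rewrite l2norm_col l2norm0 expr0n addr0.
Qed.

Lemma opnorm_block n m (S : 'M[C]_n) :
  opnorm (block_mx S 0 0 0 : 'M[C]_(n + m)) = opnorm S.
Proof.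
apply/le_anti/andP; split; apply: opnorm_le; rewrite ?opnorm_ge0 // => x.
  rewrite -(vsubmxK x) mul_block_col !mul0mx !addr0 l2norm_col0.
  apply: (le_trans (opnorm_bound _ _)); rewrite ler_wpM2l ?opnorm_ge0 //.
  rewrite -(ler_pXn2r (ltn0Sn 1)) ?nnegrE ?l2norm_ge0 //.
  by rewrite l2norm_col lerDl sqr_ge0.
have := opnorm_bound (block_mx S 0 0 0 : 'M[C]_(n + m)) (col_mx x 0).
by rewrite mul_block_col !mul0mx !addr0 !l2norm_col0.
Qed.

End OperatorNorm.

Section MatrixNorm.
Variable R : realType.
Local Notation C := R[i].

(* M_n(E) as a complex vector space and an M_n-bimodule; MathComp's own
   scaling and products of matrices require entries in a ring. *)
Section Actions.
Variable (E : lmodType C) (n : nat).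
Implicit Types (u : 'M[E]_n) (S : 'M[C]_n).

Definition scaleE (a : C) u : 'M[E]_n := map_mx ( *:%R a) u.

Definition lactE S u : 'M[E]_n := \matrix_(i, j) \sum_k S i k *: u k j.

Definition ractE u S : 'M[E]_n := \matrix_(i, j) \sum_k S k j *: u i k.

End Actions.

(* The index n = 0 is harmless: M_0(E) is the zero space, which carries only
   one norm.  Nonnegativity follows from mnormD and mnormZ. *)
Record is_matrix_norm (E : lmodType C) (N : forall n, 'M[E]_n -> R) : Prop :=
  IsMatrixNorm {
    mnormD : forall n (u w : 'M[E]_n), N n (u + w) <= N n u + N n w;
    mnormZ : forall n (a : C) (u : 'M[E]_n), N n (scaleE a u) = normc a * N n u;
    mnorm_eq0 : forall n (u : 'M[E]_n), N n u = 0 -> u = 0;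
    mnorm_block : forall n m (u : 'M[E]_n),
      N (n + m)%N (block_mx u 0 0 0) = N n u;
    mnorm_lact : forall n (S : 'M[C]_n) (u : 'M[E]_n),
      N n (lactE S u) <= opnorm S * N n u;
    mnorm_ract : forall n (u : 'M[E]_n) (S : 'M[C]_n),
      N n (ractE u S) <= N n u * opnorm S
  }.

Record mnSpace := MNSpace {
  mn_sort :> lmodType C;
  mnorm : forall n, 'M[mn_sort]_n -> R;
  mn_axioms : is_matrix_norm mnorm
}.

Definition amplification (E F : Type) (phi : E -> F) (m : nat) :
  'M[E]_m -> 'M[F]_m := map_mx phi.

Definition completely_contractive (E F : mnSpace) (phi : E -> F) : Prop :=
  forall m (u : 'M[E]_m), mnorm (amplification phi u) <= mnorm u.

Record ccop (E F : mnSpace) := CCOp {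
  cc_fun :> {linear E -> F};
  cc_contr : completely_contractive cc_fun
}.

Lemma ccop_ext (E F : mnSpace) (phi psi : ccop E F) : phi =1 psi -> phi = psi.
Proof.
case: phi psi => [[f f_lin] f_cc] [[g g_lin] g_cc] /= /funext fg.
move: f_lin f_cc; rewrite fg => f_lin f_cc.
have E1 : f_lin = g_lin.
  case: f_lin {f_cc} => -[a] [b]; case: g_lin {g_cc} => -[c] [d].
  by rewrite (Prop_irrelevance a c) (Prop_irrelevance b d).
by move: f_cc; rewrite E1 => f_cc; rewrite (Prop_irrelevance f_cc g_cc).
Qed.

Lemma cc_id_subproof (E : mnSpace) : completely_contractive (idfun : {linear E -> E}).
Proof. by move=> m u; rewrite /amplification map_mx_id. Qed.

Definition cc_id (E : mnSpace) : ccop E E := CCOp (@cc_id_subproof E).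

Lemma cc_comp_subproof (E F G : mnSpace) (psi : ccop F G) (phi : ccop E F) :
  completely_contractive (psi \o phi : {linear E -> G}).
Proof.
move=> m u; rewrite /amplification map_mx_comp.
exact: le_trans (cc_contr psi _) (cc_contr phi _).
Qed.

Definition cc_comp (E F G : mnSpace) (psi : ccop F G) (phi : ccop E F) : ccop E G :=
  CCOp (@cc_comp_subproof E F G psi phi).

(* odot n E is the closed unit ball of M_n(E). *)
Definition odot (n : nat) (E : mnSpace) : Type :=
  {u : 'M[E]_n | mnorm u <= 1}.

Lemma odot_map_subproof n (E F : mnSpace) (phi : ccop E F) (u : odot n E) :
  mnorm (amplification phi (val u)) <= 1.
Proof. exact: le_trans (cc_contr phi _) (valP u). Qed.

Definition odot_map (n : nat) (E F : mnSpace) (phi : ccop E F) :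
    odot n E -> odot n F :=
  fun u => exist _ (amplification phi (val u)) (odot_map_subproof phi u).

Lemma odot_map_id n (E : mnSpace) : @odot_map n E E (cc_id E) =1 id.
Proof. by move=> u; apply: val_inj; rewrite /= /amplification map_mx_id. Qed.

Lemma odot_map_comp n (E F G : mnSpace) (psi : ccop F G) (phi : ccop E F) :
  @odot_map n _ _ (cc_comp psi phi) =1 odot_map psi \o odot_map phi.
Proof. by move=> u; apply: val_inj; rewrite /= /amplification map_mx_comp. Qed.

(* The family I is the bijection natural in E: its domain E |-> (M -> odot n E)
   acts on morphisms by odot_map phi \o _, its codomain by cc_comp phi. *)
Definition odot_free (n : nat) (P : mnSpace) (M : Type) : Prop :=
  exists I : forall E : mnSpace, (M -> odot n E) -> ccop P E,
    (forall E, bijective (I E)) /\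
    (forall (E F : mnSpace) (phi : ccop E F) (f : M -> odot n E),
       I F (odot_map phi \o f) = cc_comp phi (I E f)).

(* The indices of l and v are transposed: this is the trace pairing. *)
Definition phi_of (n : nat) (E : lmodType C) (v : 'M[E]_n) (l : 'M[C]_n) : E :=
  \sum_i \sum_j l j i *: v i j.

Definition hat_values (n m : nat) (u : 'M['M[C]_n]_m) : set R :=
  [set r | exists (E : mnSpace) (v : 'M[E]_n),
     mnorm v <= 1 /\ r = mnorm (amplification (phi_of v) u)].

(* E ranges over the whole universe of matricially normed spaces, hatM itself
   included.  The set is nonempty and bounded (hat_has_sup), so that sup is
   its least upper bound and not the default value. *)
Definition hat_norm (n m : nat) (u : 'M['M[C]_n]_m) : R := sup (hat_values u).

Section MatrixNormTheory.
Variables (E : lmodType C) (N : forall n, 'M[E]_n -> R) (NP : is_matrix_norm N).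

Lemma mnorm0 n : N (0 : 'M[E]_n) = 0.
Proof.
rewrite (_ : 0 = scaleE 0 0) ?(mnormZ NP) ?normc0 ?mul0r //.
by apply/matrixP => i j; rewrite !mxE scaler0.
Qed.

Lemma mnorm_ge0 n (u : 'M[E]_n) : 0 <= N u.
Proof.
have := mnormD NP u (scaleE (-1) u).
rewrite (mnormZ NP) (_ : normc (-1) = 1) ?mul1r; last first.
  exact: etrans (@normcN R 1) (normc1 R).
rewrite (_ : u + _ = 0) ?mnorm0 -?mulr2n ?pmulrn_lge0 //.
by apply/matrixP => i j; rewrite !mxE scaleN1r subrr.
Qed.

Lemma mnorm_sum n (I : Type) (r : seq I) (F : I -> 'M[E]_n) :
  N (\sum_(i <- r) F i) <= \sum_(i <- r) N (F i).
Proof.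
elim: r => [|i r IH]; first by rewrite !big_nil mnorm0.
by rewrite !big_cons (le_trans (mnormD NP _ _)) // lerD2l.
Qed.

Lemma mnorm_lact_le n (S : 'M[C]_n) (u : 'M[E]_n) :
  opnorm S <= 1 -> N (lactE S u) <= N u.
Proof.
by move=> S1; apply: (le_trans (mnorm_lact NP _ _)); rewrite ler_piMl ?mnorm_ge0.
Qed.

Lemma mnorm_ract_le n (S : 'M[C]_n) (u : 'M[E]_n) :
  opnorm S <= 1 -> N (ractE u S) <= N u.
Proof.
by move=> S1; apply: (le_trans (mnorm_ract NP _ _)); rewrite ler_piMr ?mnorm_ge0.
Qed.

Lemma lact_delta n (a b : 'I_n) (u : 'M[E]_n) :
  lactE (delta_mx a b) u = \matrix_(i, j) (if i == a then u b j else 0).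
Proof.
apply/matrixP => i j; rewrite !mxE (bigD1 b) //= big1 ?addr0 => [|k kb].
  by rewrite mxE eqxx andbT; case: eqP => _; rewrite ?scale1r ?scale0r.
by rewrite mxE (negPf kb) andbF scale0r.
Qed.

Lemma ract_delta n (a b : 'I_n) (u : 'M[E]_n) :
  ractE u (delta_mx a b) = \matrix_(i, j) (if j == b then u i a else 0).
Proof.
apply/matrixP => i j; rewrite !mxE (bigD1 a) //= big1 ?addr0 => [|k kb].
  by rewrite mxE eqxx; case: eqP => _; rewrite ?scale1r ?scale0r.
by rewrite mxE (negPf kb) scale0r.
Qed.

Definition unitE n (a b : 'I_n) (y : E) : 'M[E]_n :=
  \matrix_(i, j) (if (i == a) && (j == b) then y else 0).

Lemma mnorm_const_block n (y : E) :
  N (unitE 0 0 y : 'M[E]_n.+1) = N (const_mx y : 'M[E]_1).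
Proof.
rewrite -(mnorm_block NP n (const_mx y : 'M[E]_1)); congr (N _).
apply/matrixP => i j; rewrite !mxE.
case: splitP => i' Ei; rewrite !mxE -[i == 0]val_eqE -[j == 0]val_eqE /= Ei.
  by rewrite (ord1 i') eqxx; case: splitP => j' ->; rewrite !mxE ?(ord1 j').
by rewrite /=; case: splitP => j' _; rewrite mxE.
Qed.

Lemma mnorm_entry n (v : 'M[E]_n) i j : N (const_mx (v i j) : 'M[E]_1) <= N v.
Proof.
case: n v i j => [|n] v i j; first by case: i.
rewrite -(mnorm_const_block n).
rewrite (_ : unitE _ _ _ = lactE (delta_mx 0 i) (ractE v (delta_mx j 0))).
  apply: (le_trans (mnorm_lact_le _ _)); first exact: opnorm_delta.
  by apply: mnorm_ract_le; exact: opnorm_delta.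
rewrite lact_delta ract_delta; apply/matrixP => k l; rewrite !mxE.
by case: (k == 0).
Qed.

Lemma mnorm_unit n (a b : 'I_n) y : N (unitE a b y) <= N (const_mx y : 'M[E]_1).
Proof.
case: n a b => [|n] a b; first by case: a.
rewrite -(mnorm_const_block n).
rewrite [X in N X <= _](_ : _ = lactE (delta_mx a 0) (ractE (unitE 0 0 y) (delta_mx 0 b))).
  apply: (le_trans (mnorm_lact_le _ _)); first exact: opnorm_delta.
  by apply: mnorm_ract_le; exact: opnorm_delta.
rewrite lact_delta ract_delta; apply/matrixP => k l; rewrite !mxE !eqxx.
by case: (k == a).
Qed.

Lemma mnorm_le_entries n (v : 'M[E]_n) :
  N v <= \sum_i \sum_j N (const_mx (v i j) : 'M[E]_1).
Proof.
have {1}-> : v = \sum_i \sum_j unitE i j (v i j).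
  apply/matrixP => a b; rewrite summxE (bigD1 a) //= [X in _ + X]big1 ?addr0 => [|i ia].
    rewrite summxE (bigD1 b) //= [X in _ + X]big1 ?addr0 => [|j jb]; rewrite mxE ?eqxx //.
    by rewrite [b == j]eq_sym (negPf jb) andbF.
  by rewrite summxE big1 // => j _; rewrite mxE eq_sym (negPf ia).
apply: (le_trans (mnorm_sum _ _)); apply: ler_sum => i _.
apply: (le_trans (mnorm_sum _ _)); apply: ler_sum => j _.
exact: mnorm_unit.
Qed.

Lemma mnorm_phi_of n (v : 'M[E]_n) (l : 'M[C]_n) : N v <= 1 ->
  N (const_mx (phi_of v l) : 'M[E]_1) <= \sum_i \sum_j normc (l j i).
Proof.
move=> v1; rewrite (_ : const_mx _ =
    \sum_i \sum_j scaleE (l j i) (const_mx (v i j) : 'M[E]_1)).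
  apply: (le_trans (mnorm_sum _ _)); apply: ler_sum => i _.
  apply: (le_trans (mnorm_sum _ _)); apply: ler_sum => j _.
  rewrite (mnormZ NP) ler_piMr ?normc_ge0 //.
  exact: le_trans (mnorm_entry _ _ _) v1.
apply/matrixP => a b; rewrite mxE summxE; apply: eq_bigr => i _.
by rewrite summxE; apply: eq_bigr => j _; rewrite !mxE.
Qed.

End MatrixNormTheory.

Lemma phi_of_is_linear n (E : lmodType C) (v : 'M[E]_n) : linear (phi_of v).
Proof.
move=> a l k; rewrite /phi_of scaler_sumr -big_split /=; apply: eq_bigr => i _.
rewrite scaler_sumr -big_split /=; apply: eq_bigr => j _.
by rewrite !mxE scalerDl scalerA.
Qed.

HB.instance Definition _ n (E : lmodType C) (v : 'M[E]_n) :=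
  GRing.isLinear.Build C 'M[C]_n E _ (phi_of v) (@phi_of_is_linear n E v).

Lemma ampl_lact (E F : lmodType C) (phi : {linear E -> F}) n
    (S : 'M[C]_n) (u : 'M[E]_n) :
  amplification phi (lactE S u) = lactE S (amplification phi u).
Proof.
apply/matrixP => i j; rewrite !mxE linear_sum; apply: eq_bigr => k _.
by rewrite linearZ mxE.
Qed.

Lemma ampl_ract (E F : lmodType C) (phi : {linear E -> F}) n
    (S : 'M[C]_n) (u : 'M[E]_n) :
  amplification phi (ractE u S) = ractE (amplification phi u) S.
Proof.
apply/matrixP => i j; rewrite !mxE linear_sum; apply: eq_bigr => k _.
by rewrite linearZ mxE.
Qed.

Lemma ampl_scale (E F : lmodType C) (phi : {linear E -> F}) n
    (a : C) (u : 'M[E]_n) :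
  amplification phi (scaleE a u) = scaleE a (amplification phi u).
Proof. by apply/matrixP => i j; rewrite !mxE linearZ. Qed.

Lemma amplD (E F : lmodType C) (phi : {linear E -> F}) n (u w : 'M[E]_n) :
  amplification phi (u + w) = amplification phi u + amplification phi w.
Proof. by apply/matrixP => i j; rewrite !mxE linearD. Qed.

Lemma ampl_block (E F : lmodType C) (phi : {linear E -> F}) n m (u : 'M[E]_n) :
  amplification phi (block_mx u 0 0 0 : 'M[E]_(n + m))
  = block_mx (amplification phi u) 0 0 0.
Proof.
rewrite /amplification map_block_mx; congr block_mx;
  by apply/matrixP => i j; rewrite !mxE linear0.
Qed.

(* The complex numbers, with the operator norms on M_n(C) = M_n. *)
Lemma opnorm_is_matrix_norm : @is_matrix_norm C^o (fun n => @opnorm R n).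
Proof.
split => [n u w|n a u|n u|n m u|n S u|n u S].
- exact: opnormD.
- by rewrite -opnormZ; congr opnorm; apply/matrixP => i j; rewrite !mxE.
- exact: opnorm_eq0.
- exact: opnorm_block.
- rewrite (_ : lactE S u = S *m u) ?opnormM //.
  by apply/matrixP => i j; rewrite !mxE.
- rewrite (_ : ractE u S = (u : 'M[C]_n) *m S) ?opnormM //.
  by apply/matrixP => i j; rewrite !mxE; apply: eq_bigr => k _; rewrite mulrC.
Qed.

Definition C_mn : mnSpace := MNSpace opnorm_is_matrix_norm.

Section HatNorm.
Variable n : nat.

Lemma hat_values_neq0 m (u : 'M['M[C]_n]_m) : hat_values u !=set0.
Proof.
exists (mnorm (amplification (phi_of (0 : 'M[C_mn]_n)) u)), C_mn, 0.
by split => //; rewrite (mnorm0 (mn_axioms C_mn)) ler01.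
Qed.

Lemma hat_has_sup m (u : 'M['M[C]_n]_m) : has_sup (hat_values u).
Proof.
split; first exact: hat_values_neq0.
exists (\sum_a \sum_b \sum_i \sum_j normc (u a b j i)) => _ [E] [v] [v1 ->].
apply: (le_trans (mnorm_le_entries (mn_axioms E) _)).
apply: ler_sum => a _; apply: ler_sum => b _; rewrite mxE.
exact: (mnorm_phi_of (mn_axioms E)).
Qed.

Lemma hat_norm_ub m (u : 'M['M[C]_n]_m) (E : mnSpace) (v : 'M[E]_n) :
  mnorm v <= 1 -> mnorm (amplification (phi_of v) u) <= hat_norm u.
Proof.
by move=> v1; apply: (ub_le_sup (proj2 (hat_has_sup u))); exists E, v.
Qed.

Lemma hat_norm_le m (u : 'M['M[C]_n]_m) (c : R) :
  (forall (E : mnSpace) (v : 'M[E]_n),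
     mnorm v <= 1 -> mnorm (amplification (phi_of v) u) <= c) -> hat_norm u <= c.
Proof.
move=> uc; apply: ge_sup; first exact: hat_values_neq0.
by move=> _ [E] [v] [v1 ->]; exact: uc.
Qed.

Lemma hat_norm_ge0 m (u : 'M['M[C]_n]_m) : 0 <= hat_norm u.
Proof.
have v1 : mnorm (0 : 'M[C_mn]_n) <= 1 by rewrite (mnorm0 (mn_axioms C_mn)) ler01.
exact: le_trans (mnorm_ge0 (mn_axioms C_mn) _) (hat_norm_ub u v1).
Qed.

Lemma hat_is_matrix_norm : @is_matrix_norm 'M[C]_n (@hat_norm n).
Proof.
split => [m u w|m a u|m u|m k u|m S u|m u S].
- apply: hat_norm_le => E v v1; rewrite amplD.
  by apply: (le_trans (mnormD (mn_axioms E) _ _)); rewrite lerD ?hat_norm_ub.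
- move: a u; apply: (@homogeneousW _ _ (@hat_norm n m) (@scaleE 'M[C]_n m)).
  + by move=> a b u; apply/matrixP => i j; rewrite !mxE scalerA.
  + by move=> u; apply/matrixP => i j; rewrite !mxE scale1r.
  + move=> u; apply/le_anti; rewrite hat_norm_ge0 andbT.
    apply: hat_norm_le => E v v1.
    by rewrite ampl_scale (mnormZ (mn_axioms E)) normc0 mul0r.
  + move=> a u; apply: hat_norm_le => E v v1.
    by rewrite ampl_scale (mnormZ (mn_axioms E)) ler_wpM2l ?normc_ge0 ?hat_norm_ub.
- move=> u0; apply/matrixP => a b; apply/matrixP => i j; rewrite !mxE.
  have v1 : mnorm (delta_mx j i : 'M[C_mn]_n) <= 1 by exact: opnorm_delta.
  have := hat_norm_ub u v1; rewrite u0 => le0.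
  have /(mnorm_eq0 (mn_axioms C_mn))/matrixP/(_ a b) :
      mnorm (amplification (phi_of (delta_mx j i : 'M[C_mn]_n)) u) = 0.
    by apply/le_anti; rewrite le0 (mnorm_ge0 (mn_axioms C_mn)).
  rewrite !mxE /phi_of (bigD1 j) //= [X in _ + X]big1 ?addr0 => [|k kj]; last first.
    by rewrite big1 // => l _; rewrite mxE (negPf kj) scaler0.
  rewrite (bigD1 i) //= [X in _ + X]big1 ?addr0 => [|l li]; last first.
    by rewrite mxE (negPf li) andbF scaler0.
  by rewrite mxE !eqxx => <-; rewrite [_ *: _]mulr1.
- by congr sup; rewrite predeqE => r; split => -[E] [v] [v1 ->]; exists E, v;
    rewrite ampl_block (mnorm_block (mn_axioms E)).
- apply: hat_norm_le => E v v1; rewrite ampl_lact.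
  apply: (le_trans (mnorm_lact (mn_axioms E) _ _)).
  by rewrite ler_wpM2l ?opnorm_ge0 ?hat_norm_ub.
- apply: hat_norm_le => E v v1; rewrite ampl_ract.
  apply: (le_trans (mnorm_ract (mn_axioms E) _ _)).
  by rewrite ler_wpM2r ?opnorm_ge0 ?hat_norm_ub.
Qed.

Definition hatM : mnSpace := MNSpace hat_is_matrix_norm.

End HatNorm.

End MatrixNorm.

(* Main.v *)
Require Import Defs.
From mathcomp Require Import all_boot all_order all_algebra.
From mathcomp Require Import reals complex.
From mathcomp Require Import boolp.

(** The matrix [U] of transposed matrix units is universal: [phi_of v] maps it
    to [v], so it has norm at most 1 in [M_n(hatM)], and [v |-> phi_of v] has
    the inverse [psi |-> psi_n(U)]. *)

Set Implicit Arguments.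
Unset Strict Implicit.
Unset Printing Implicit Defensive.
Import GRing.Theory.
Local Open Scope ring_scope.

Section Universal.
Variables (R : realType) (n : nat).
Local Notation C := R[i].

(** A linear map out of ['M[C]_n] is determined by its values on the matrix units, so
    [v |-> phi_of v] and [psi |-> psi_n(U)] are mutually inverse between matrices over [E] and
    linear maps ([ampl_phi_of_units], [phi_of_ampl_units]). The norm of [hatM] restricts this to
    unit balls and complete contractions: it dominates every [phi_of v] with [v] in the ball
    ([phi_of_contractive]), yet keeps [U] in the ball ([hat_norm_units]). *)

Definition transposed_units : 'M[hatM R n]_n :=
  \matrix_(i, j) (delta_mx j i : 'M[C]_n).

Lemma ampl_phi_of_units (E : lmodType C) (v : 'M[E]_n) :
  amplification (phi_of v) transposed_units = v.
Proof.
apply/matrixP => i j; rewrite !mxE /phi_of (bigD1 i) //= (bigD1 j) //=.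
rewrite mxE !eqxx scale1r big1 => [|l lj]; last first.
  by rewrite mxE (negPf lj) scale0r.
rewrite addr0 big1 ?addr0 // => k ki; rewrite big1 // => l _.
by rewrite mxE (negPf ki) andbF scale0r.
Qed.

Lemma phi_of_ampl_units (E : lmodType C) (psi : {linear 'M[C]_n -> E}) :
  phi_of (amplification psi transposed_units) =1 psi.
Proof.
(* The swap of sums matches the transposed indices in [phi_of]. *)
move=> l; rewrite [in RHS](matrix_sum_delta l) exchange_big linear_sum.
apply: eq_bigr => i _; rewrite linear_sum; apply: eq_bigr => j _.
by rewrite linearZ !mxE.
Qed.

(** Each value in the supremum defining this norm is the norm of [v] itself. *)
Lemma hat_norm_units : mnorm transposed_units <= 1.
Proof. by apply: hat_norm_le => E v v1; rewrite ampl_phi_of_units. Qed.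

(** This gives naturality in [E]. *)
Lemma phi_of_ampl (E F : lmodType C) (psi : {linear E -> F}) (v : 'M[E]_n) :
  phi_of (amplification psi v) =1 psi \o phi_of v.
Proof.
move=> l; rewrite /= linear_sum; apply: eq_bigr => i _.
by rewrite linear_sum; apply: eq_bigr => j _; rewrite linearZ mxE.
Qed.

(** The pair of [E] and [v] is one of those over which the hat norm is a supremum. *)
Lemma phi_of_contractive (E : mnSpace R) (v : odot n E) :
  @completely_contractive R (hatM R n) E (phi_of (val v)).
Proof. by move=> m u; exact: (hat_norm_ub u (valP v)). Qed.

Definition cc_phi_of (E : mnSpace R) (v : odot n E) : ccop (hatM R n) E :=
  @CCOp R (hatM R n) E (phi_of (val v)) (@phi_of_contractive E v).

Definition odot_units : odot n (hatM R n) := Sub transposed_units hat_norm_units.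

End Universal.

Theorem theorem2 (R : realType) (n : nat) : odot_free n (hatM R n) unit.
Proof.
exists (fun E f => cc_phi_of (f tt)); split=> [E|E F phi f]; last first.
  by apply: ccop_ext => l; exact: phi_of_ampl.
exists (fun psi _ => odot_map psi (odot_units R n)) => [f|psi].
  by apply/funext => -[]; apply: val_inj; exact: ampl_phi_of_units.
by apply: ccop_ext => l; exact: (phi_of_ampl_units psi).
Qed.
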